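(* Let $\alpha>0$, $\rho<0$, and let $(X_i)_{i\ge1}$ be a sequence of continuous i.i.d. real random variables (i.e. with continuous common distribution function $F$) such that $\overline F=1-F\in2\mathrm{RV}_{-\alpha,\rho}$ with auxiliary function $A$. Let $a_n=F^{\leftarrow}(1-1/n)$ and $M_n=\max(X_1,\dots,X_n)$. Then there exists a constant $C>0$ such that for every $n\ge2$ with $a_n>0$, $$\mathrm d_K\big(a_n^{-1}M_n,\mathcal F(\alpha)\big)\le C\Big(\frac1n+|A(a_n)|\Big).$$
   Context: $\mathcal F(\alpha)$ is the Fréchet distribution, with distribution function $\exp(-x^{-\alpha})$, $x>0$. $F^{\leftarrow}(y)=\inf\{x\in\mathbb R:F(x)\ge y\}$, $y\in(0,1)$. $\mathrm d_K(X,Y)=\sup_{z\in\mathbb R}|\mathbb P(X\le z)-\mathbb P(Y\le z)|$ is the Kolmogorov distance between the laws of $X$ and $Y$ (random variable and law are identified in the notation). Regular variation: $h\in\mathrm{RV}_\gamma$ means $\lim_{t\to\infty}h(tx)/h(t)=x^\gamma$ for all $x>0$. For $\rho<0$, $h\in 2\mathrm{RV}_{\gamma,\rho}$ with auxiliary function $A$ means that $h\in\mathrm{RV}_\gamma$ and $A$ is an ultimately positive or ultimately negative function such that for all $x>0$, $\lim_{t\to\infty}\frac1{A(t)}\big(\frac{h(tx)}{h(t)}-x^\gamma\big)=x^\gamma\frac{x^\rho-1}{\rho}$. If $\overline F\in2\mathrm{RV}_{-\alpha,\rho}$ with $\rho<0$, then $\overline F(x)=\ell x^{-\alpha}L(x)$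 with $\ell>0$, $\lim_{t\to\infty}L(t)=1$ and $|1-L|\in\mathrm{RV}_\rho$; the auxiliary function is taken to be $A(t)=-\rho(1-L(t))/L(t)$. *)

(* Defs.v *)
From HB Require Import structures.
From mathcomp Require Import all_boot all_order all_algebra.
From mathcomp Require Import all_classical all_reals all_analysis.
From mathcomp Require Import measurable_realfun.

Set Implicit Arguments.
Unset Strict Implicit.
Unset Printing Implicit Defensive.

Import Order.TTheory GRing.Theory Num.Theory.
Import numFieldNormedType.Exports.

Local Open Scope classical_set_scope.
Local Open Scope ring_scope.

Section regular_variation.
Context {R : realType}.
Implicit Types (h A : R -> R) (gamma rho : R).

Definition regularly_varying gamma h :=
  forall x, 0 < x -> h (t * x) / h t @[t --> +oo] --> x `^ gamma.

(* Meant for [rho < 0]. *)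
Definition second_order_regularly_varying gamma rho A h :=
  [/\ regularly_varying gamma h,
      (\forall t \near +oo, 0 < A t) \/ (\forall t \near +oo, A t < 0) &
      forall x, 0 < x ->
        (A t)^-1 * (h (t * x) / h t - x `^ gamma) @[t --> +oo] -->
          x `^ gamma * ((x `^ rho - 1) / rho)].

Definition quantile (F : R -> R) (y : R) : R := inf [set x | y <= F x].

Definition kolmogorov_distance (mu nu : probability R R) : R :=
  sup [set `|fine (mu `]-oo, z]%classic) - fine (nu `]-oo, z]%classic)| | z in [set: R]].

End regular_variation.

Section random_sequences.
Context {d : measure_display} {T : measurableType d} {R : realType}
  {P : probability T R}.
Implicit Type X : nat -> {RV P >-> R}.

Definition mutually_independent X :=
  forall (s : seq nat) (B : nat -> set R), uniq s ->
    (forall i, measurable (B i)) ->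
    P (\bigcap_(i in [set` s]) (X i @^-1` B i)) =
    (\prod_(i <- s) P (X i @^-1` B i))%E.

Definition identically_distributed X :=
  forall (i j : nat) (B : set R), measurable B ->
    distribution P (X i) B = distribution P (X j) B.

Definition iid X := mutually_independent X /\ identically_distributed X.

Definition real_cdf (X : {RV P >-> R}) (x : R) : R := fine (cdf X x).

(* The sequence is indexed from 0, so for [n >= 1] this is the maximum of the
   first [n] variables [X 0, ..., X n.-1]; for [n = 0] it is [X 0]. *)
Definition sample_max X (n : nat) : T -> R :=
  fun w => \big[Num.max/X 0%N w]_(i < n) X i w.

Lemma measurable_sample_max X n : measurable_fun [set: T] (sample_max X n).
Proof.
rewrite /sample_max; elim: (index_enum _) => [|i s IH].
  rewrite (_ : (fun _ => _) = X 0%N); first exact: measurable_funPT.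
  by apply/funext => w; rewrite big_nil.
under eq_fun do rewrite big_cons.
by apply: measurable_maxr => //; exact: measurable_funPT.
Qed.

HB.instance Definition _ X n := isMeasurableFun.Build _ _ _ _
  (sample_max X n) (measurable_sample_max X n).

End random_sequences.

Section frechet.
Context {R : realType} (alpha : {posnum R}).
Local Notation a := (alpha%:num).

Definition frechet_cdf (x : R) : R :=
  if 0 < x then expR (- (x `^ (- a))) else 0.

Lemma frechet_cdf_nondecreasing : nondecreasing frechet_cdf.
Proof.
move=> x y xy; rewrite /frechet_cdf.
case: ifPn => [x0|_]; last by case: ifPn => // _; exact: expR_ge0.
have y0 := lt_le_trans x0 xy.
rewrite y0 ler_expR lerN2 !powRN lef_pV2 ?posrE ?powR_gt0//.
by apply: ge0_ler_powR => //; rewrite nnegrE ltW.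
Qed.

Lemma frechet_cdf_continuous_pos (x : R) : 0 < x -> frechet_cdf @ x --> frechet_cdf x.
Proof.
move=> x0; rewrite {2}/frechet_cdf x0.
apply: (@cvg_trans _ (expR (- (y `^ (- a))) @[y --> x])).
  apply: near_eq_cvg; near=> y; rewrite /frechet_cdf ifT//.
  by near: y; exact: lt_nbhsr.
apply: (@cvg_comp _ _ _ (fun y : R => - y `^ (- a)) expR _
  (nbhs (- x `^ (- a)))); last exact: continuous_expR.
apply: cvgN.
have : derivable (@powR R ^~ (- a)) x 1.
  by apply: derivable_powR; rewrite in_itv/= x0.
by move/derivable1_diffP/differentiable_continuous.
Unshelve. all: by end_near. Qed.

Lemma frechet_cdf_right_continuous : right_continuous frechet_cdf.
Proof.
move=> x; have [x0|] := ltP 0 x.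
  by apply: cvg_at_right_filter; exact: frechet_cdf_continuous_pos.
rewrite le_eqVlt => /predU1P[->|x0]; last first.
  rewrite {2}/frechet_cdf ltNge ltW//=.
  apply: (@cvg_trans _ ((cst 0 : R -> R) y @[y --> x^'+])); last exact: cvg_cst.
  apply: near_eq_cvg; near=> y; rewrite /frechet_cdf ifF//.
  apply/negbTE; rewrite -leNgt; apply: ltW.
  by near: y; exact: nbhs_right_lt.
have -> : frechet_cdf 0 = 0 by rewrite /frechet_cdf ltxx.
apply: (@squeeze_cvgr _ _ _ _ (cst 0) (@powR R ^~ a)).
- near=> y; have y0 : 0 < y by near: y; exact: nbhs_right_gt.
  rewrite /frechet_cdf y0 expR_ge0/= powRN expRN.
  rewrite -[leRHS]invrK lef_pV2 ?posrE ?expR_gt0 ?invr_gt0 ?powR_gt0//.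
  by apply: le_trans (expR_ge1Dx _); rewrite lerDr.
- exact: cvg_cst.
- exact: powR_cvg0.
Unshelve. all: by end_near. Qed.

Lemma frechet_cdfNy : frechet_cdf @ -oo --> (0 : R).
Proof.
apply: (@cvg_trans _ ((cst 0 : R -> R) y @[y --> -oo])); last exact: cvg_cst.
apply: near_eq_cvg; near=> y; rewrite /frechet_cdf ifF//.
by apply/negbTE; rewrite -leNgt; near: y; exact: nbhs_ninfty_le.
Unshelve. all: by end_near. Qed.

Lemma frechet_cdfy : frechet_cdf @ +oo --> (1 : R).
Proof.
have yV : (fun y : R => y^-1) @ +oo --> 0^'+.
  have yV0 : (fun y : R => y^-1) @ +oo --> (0 : R).
    by apply/(gtr0_cvgV0 (f := id)) => //; exact: nbhs_pinfty_gt.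
  move=> B /yV0 B0.
  have y0 : \forall y \near +oo, 0 < (y : R)^-1.
    by near=> y; rewrite invr_gt0; near: y; exact: nbhs_pinfty_gt.
  by apply: filterS2 B0 y0 => y; apply.
have ya : y `^ (- a) @[y --> +oo] --> (0 : R).
  apply: (@cvg_trans _ ((y^-1) `^ a @[y --> +oo])).
    apply: near_eq_cvg; near=> y.
    by rewrite powRN -powR_inv1// powRAC powR_inv1 ?powR_ge0.
  exact: (cvg_comp _ _ yV (powR_cvg0 _)).
apply: (@cvg_trans _ (expR (- (y `^ (- a))) @[y --> +oo])).
  apply: near_eq_cvg; near=> y; rewrite /frechet_cdf ifT//.
rewrite -[1 : R]expR0 -[in expR 0](@oppr0 R).
apply: (@cvg_comp _ _ _ (fun y : R => - y `^ (- a)) expR _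
  (nbhs (- (0 : R)))); last exact: continuous_expR.
exact: cvgN.
Unshelve. all: by end_near. Qed.

HB.instance Definition _ := isCumulative.Build R _ R frechet_cdf
  frechet_cdf_nondecreasing frechet_cdf_right_continuous.

HB.instance Definition _ := isCumulativeBounded.Build R 0 1 frechet_cdf
  frechet_cdfNy frechet_cdfy.

(* The library builds Stieltjes measures on [measurableTypeR R], which differs
   from the canonical measurable type of [R] only by its display; the identity
   carries the law over to [R]. *)
Definition borel_id : measurableTypeR R -> R := idfun.

HB.instance Definition _ :=
  @isMeasurableFun.Build _ _ _ _ borel_id (@measurable_id _ _ setT).

Definition frechet : probability R R :=
  distribution (lebesgue_stieltjes_measure frechet_cdf) borel_id.

Lemma frechetE (x : R) : frechet `]-oo, x]%classic = (frechet_cdf x)%:E.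
Proof. exact: (cdf_lebesgue_stieltjes_id frechet_cdf). Qed.

End frechet.

(* Main.v *)
Require Import Defs.
From HB Require Import structures.
From mathcomp Require Import all_boot all_order all_algebra.
From mathcomp Require Import all_classical all_reals all_analysis.
From mathcomp Require Import measurable_realfun.
From mathcomp Require Import ring lra.

Import Order.TTheory GRing.Theory Num.Theory.
Import numFieldNormedType.Exports.

Local Open Scope classical_set_scope.
Local Open Scope ring_scope.

(* With G = 1 - F and phi(s) = ln G(e^s) + alpha s, the second-order condition
   says that the increments phi(s + u) - phi(s), divided by A(e^s), converge to
   (e^(rho u) - 1) / rho for each fixed u. A Baire argument makes the bound on
   the increments uniform for u near 0; chaining such steps, along which A
   decays geometrically, yields a Potter-type bound
     G(t x) / G(t) = x^(-alpha) e^D,  |D| <= M |A(t)| (1 + x^(-alpha m)),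
   valid whenever t and t x are large. At t = a_n one has G(t) = 1/n, so
   P(M_n <= t x) = (1 - G(t x))^n is within 8/n of exp(- n G(t x)), which by the
   bound on D is within O(|A(t)|) of exp(- x^(-alpha)). When t x is not large,
   both distribution functions are O(1/n). *)

(** * Increments of [phi] in logarithmic coordinates *)

(** The limits for [phi] alone determine how [a] varies under a shift. This is what allows a bound
    by [a (s + u)] to be traded for one by [a s]. *)
Lemma auxiliary_shift_cvg {R : realType} {rho : R} {phi a : R -> R} : rho < 0 ->
  (\forall s \near +oo, a s != 0) ->
  (forall u, (phi (s + u) - phi s) / a s @[s --> +oo] -->
     (expR (rho * u) - 1) / rho) ->
  forall u, a (s + u) / a s @[s --> +oo] --> expR (rho * u).
Proof.
move=> rho0 a0 phia u.
pose H v := (expR (rho * v) - 1) / rho.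
have H1 : H 1 != 0.
  by rewrite /H mulr1 mulf_neq0 ?invr_eq0 ?lt_eqF// subr_lt0 ?expR_lt1//.
have phi1 : (phi (s + u + 1) - phi (s + u)) / a (s + u) @[s --> +oo] --> H 1.
  exact: (cvg_comp _ _ (cvg_addrr u) (phia 1)).
have au0 : \forall s \near +oo, a (s + u) != 0.
  exact: (cvg_addrr u a0).
(* Cocycle identity: the increment over [1] from [s + u] is the difference of the
   increments over [u + 1] and [u] from [s]. *)
have -> : expR (rho * u) = (H (u + 1) - H u) / H 1.
  rewrite /H mulrDr expRD mulr1; field.
  by rewrite lt_eqF//= subr_eq0 lt_eqF// ?expR_lt1//.
apply: cvg_trans (cvgM (cvgB (phia (u + 1)) (phia u)) (cvgV H1 phi1)).
apply: near_eq_cvg; near=> s.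
have as0 : a s != 0 by near: s.
have asu0 : a (s + u) != 0 by near: s.
have d0 : (phi (s + u + 1) - phi (s + u)) / a (s + u) != 0.
  by near: s; exact: cvgr_neq0 phi1 H1.
have {}d0 : phi (s + u + 1) - phi (s + u) != 0.
  by apply: contraNneq d0 => ->; rewrite mul0r.
rewrite -[LHS]/(((phi (s + (u + 1)) - phi s) / a s - (phi (s + u) - phi s) / a s)
  / ((phi (s + u + 1) - phi (s + u)) / a (s + u))).
by rewrite addrA; field; rewrite d0 asu0 as0.
Unshelve. all: by end_near. Qed.

(* [\bigcup_n E n] covers the line, where the closed sets [E n] collect the
   increments [u] whose bound holds with constant [n] from [n] onwards; Baire
   gives one of them an interior point [p], and shifting by [p] moves the
   interval to the origin. *)
Lemma local_uniform_increment {R : realType} {rho : R} {phi a : R -> R} :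
  rho < 0 -> continuous phi ->
  (\forall s \near +oo, a s != 0) ->
  (forall u, (phi (s + u) - phi s) / a s @[s --> +oo] -->
     (expR (rho * u) - 1) / rho) ->
  exists delta M : R, [/\ 0 < delta, 0 <= M & \forall s \near +oo,
    forall u, 0 <= u <= delta -> `|phi (s + u) - phi s| <= M * `|a s| ].
Proof.
move=> rho0 cphi a0 phia.
pose E (n : nat) := [set u : R |
  forall s, n%:R <= s -> `|phi (s + u) - phi s| <= n%:R * `|a s| ].
have closedE n : closed (E n).
  rewrite (_ : E n = \bigcap_(s in [set s | n%:R <= s])
      (fun u => `|phi (s + u) - phi s|) @^-1` [set y | y <= n%:R * `|a s| ]).
    apply: closed_bigI => s _.
    apply: preimage_closed; last exact: closed_le.
    move=> u _; apply: cvg_norm; apply: cvgB; last exact: cvg_cst.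
    apply: (@cvg_comp _ _ _ (fun u => s + u) phi _ (nbhs (s + u))).
      by apply: cvgD; [exact: cvg_cst|exact: cvg_id].
    exact: cphi.
  by [].
have coverE u : exists n, E n u.
  have /cvgr_norm_lt /(_ (`|(expR (rho * u) - 1) / rho| + 1)) := phia u.
  rewrite ltrDl ltr01 => /(_ isT) bd.
  have {bd} : \forall s \near +oo, `|phi (s + u) - phi s| <=
      (`|(expR (rho * u) - 1) / rho| + 1) * `|a s|.
    near=> s.
    have as0 : a s != 0 by near: s.
    rewrite -ler_pdivrMr ?normr_gt0// -normf_div ltW//.
    by near: s.
  move=> [S [_ bd]].
  set K := _ + 1 in bd.
  pose n := (Num.bound `|S| + Num.bound `|K|)%N.
  exists n => s ns.
  have Sn : S < n%:R.
    apply: le_lt_trans (ler_norm _) _; apply: lt_le_trans (archi_boundP _) _ => //.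
    by rewrite ler_nat leq_addr.
  have Kn : K <= n%:R.
    apply: le_trans (ler_norm _) _; apply/ltW/(lt_le_trans (archi_boundP _)) => //.
    by rewrite ler_nat leq_addl.
  apply: le_trans (bd s (lt_le_trans Sn ns)) _.
  by rewrite ler_wpM2r.
(* If no [E n] had an interior point, the complements would be open and dense, and Baire would give
   a point outside every [E n], against [coverE]. *)
have [n [p intp]] : exists n p, interior (E n) p.
  apply: contrapT => /forallNP noint.
  have oE n : open (~` E n) /\ dense (~` E n : set R^o).
    split; first exact: closed_openC.
    move=> O [x Ox] oO.
    apply: contrapT => /forallNP OE.
    apply: (noint n); exists x.
    apply: filterS (open_nbhs_nbhs (conj oO Ox)) => y Oy.
    by apply: contrapT => Ey; apply: (OE y).
  have [||x [_ Ex]] := Baire oE (O := setT); [by exists 0 | exact: openT |].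
  by have [n En] := coverE x; exact: (Ex n I).
have /nbhs_ballP[e /= e0 ballE] := intp.
have Ep : E n p by apply: ballE; exact: ballxx.
have bp := auxiliary_shift_cvg rho0 a0 phia (- p).
(* Half the radius keeps [p + u] inside the open ball. The increment from [s] to [s + u] is a
   difference of two increments from [s - p], hence the factor 2; [expR (rho * - p) + 1] eventually
   bounds [|a (s - p)| / |a s|]. *)
exists (e / 2), (2 * n%:R * (expR (rho * - p) + 1)); split.
- by rewrite divr_gt0.
- by rewrite !mulr_ge0// addr_ge0// expR_ge0.
near=> s => u /andP[u0 ue].
have as0 : a s != 0 by near: s.
have sn : n%:R <= s + - p.
  by rewrite lerBrDl; near: s; apply: nbhs_pinfty_ge; exact: num_real.
have asp : `|a (s + - p)| <= (expR (rho * - p) + 1) * `|a s|.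
  rewrite -ler_pdivrMr ?normr_gt0// -normf_div ltW//.
  near: s; apply: cvgr_norm_lt bp _ _.
  by rewrite ger0_norm ?expR_ge0// ltrDl.
have Epu : E n (p + u).
  apply: ballE; rewrite /ball/= opprD addrA subrr sub0r normrN ger0_norm//.
  by apply: le_lt_trans ue _; rewrite ltr_pdivrMr// ltr_pMr// ltr1n.
have := Epu _ sn; rewrite addrA subrK => h1.
have := Ep _ sn; rewrite subrK => h2.
have -> : phi (s + u) - phi s =
  (phi (s + u) - phi (s - p)) - (phi s - phi (s - p)) by ring.
apply: le_trans (ler_normB _ _) _; apply: le_trans (lerD h1 h2) _.
by rewrite -mulr2n -[leLHS]mulr_natl -!mulrA ler_pM2l// ler_wpM2l.
Unshelve. all: by end_near. Qed.

(** Over a step [delta], [|a|] shrinks by a factor q < 1, so chained forward increments are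
    dominated by a geometric series. Backwards, [|a|] grows by at most e^(kappa delta) per step,
    which produces the exponential term. The strict inequality - rho < kappa leaves room, since e^(-
    rho delta) is only the limit of this growth. *)
Lemma uniform_increment {R : realType} {rho : R} {phi a : R -> R} (kappa : R) :
  rho < 0 -> - rho < kappa -> continuous phi ->
  (\forall s \near +oo, a s != 0) ->
  (forall u, (phi (s + u) - phi s) / a s @[s --> +oo] -->
     (expR (rho * u) - 1) / rho) ->
  exists S M : R, 0 <= M /\ forall s s', S <= s -> S <= s' ->
    `|phi s' - phi s| <= M * `|a s| * (1 + expR (kappa * (s - s'))).
Proof.
move=> rho0 rhok cphi a0 phia.
have [delta [M [d0 M0 locM]]] := local_uniform_increment rho0 cphi a0 phia.
have ad := auxiliary_shift_cvg rho0 a0 phia delta.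
(* The midpoint between 1 and the limit of [a (s + delta) / a s]. *)
pose q := (expR (rho * delta) + 1) / 2.
have e1 : expR (rho * delta) < 1 by rewrite expR_lt1 nmulr_rlt0.
have [q0 q1] : 0 < q /\ q < 1.
  by rewrite /q; have := expR_gt0 (rho * delta); split; lra.
have : \forall s \near +oo, [/\ `|a (s + delta)| <= q * `|a s|,
    `|a s| <= expR (kappa * delta) * `|a (s + delta)| &
    forall u, 0 <= u <= delta -> `|phi (s + u) - phi s| <= M * `|a s| ].
  near=> s.
  have as0 : a s != 0 by near: s.
  split.
  - rewrite -ler_pdivrMr ?normr_gt0// -normf_div ltW//.
    near: s; apply: cvgr_norm_lt ad _ _.
    by rewrite ger0_norm ?expR_ge0// /q; lra.
  - rewrite mulrC -ler_pdivrMr ?expR_gt0// -expRN mulrC.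
    rewrite -ler_pdivlMr ?normr_gt0// -normf_div ltW//.
    near: s; apply: cvgr_norm_gt ad _ _.
    rewrite ger0_norm ?expR_ge0// ltr_expR -mulNr ltr_pM2r//; lra.
  - by near: s.
case=> S [_ HS].
have {HS} HS s : S + 1 <= s -> [/\ `|a (s + delta)| <= q * `|a s|,
    `|a s| <= expR (kappa * delta) * `|a (s + delta)| &
    forall u, 0 <= u <= delta -> `|phi (s + u) - phi s| <= M * `|a s| ].
  by move=> Ss; apply: HS; lra.
set T := S + 1 in HS.
(* Sum of the geometric series, used through its fixed-point equation M1 = M1 q + M, which closes
   the induction on the number of steps. *)
pose M1 := M / (1 - q).
have M10 : 0 <= M1 by rewrite divr_ge0// subr_ge0 ltW.
have M1E : M1 = M1 * q + M by rewrite /M1; field; rewrite subr_eq0 gt_eqF.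
clearbody M1.
have fwdn n s u : T <= s -> 0 <= u <= n%:R * delta ->
    `|phi (s + u) - phi s| <= M1 * `|a s|.
  elim: n s u => [|n IH] s u Ts /andP[u0 un].
    have -> : u = 0 by apply/eqP; rewrite eq_le u0 andbT; rewrite mul0r in un.
    by rewrite addr0 subrr normr0 mulr_ge0.
  have [aq _ loc] := HS s Ts.
  have as0 : 0 <= `|a s| by [].
  have [ud|du] := leP u delta.
    apply: le_trans (loc u _) _; first by rewrite u0.
    by rewrite ler_wpM2r// M1E lerDr mulr_ge0// ltW.
  have -> : phi (s + u) - phi s =
    (phi (s + delta + (u - delta)) - phi (s + delta)) + (phi (s + delta) - phi s).
    by rewrite (_ : s + delta + (u - delta) = s + u); ring.
  apply: le_trans (ler_normD _ _) _.
  apply: le_trans (lerD (IH _ _ _ _) (loc delta _)) _.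
  - by lra.
  - by rewrite subr_ge0 ltW//= lerBlDr; rewrite -natr1 mulrDl mul1r in un.
  - by rewrite lexx ltW.
  by rewrite {2}M1E mulrDl lerD2r -mulrA ler_wpM2l.
have fwd s s' : T <= s -> s <= s' -> `|phi s' - phi s| <= M1 * `|a s|.
  move=> Ts ss'; rewrite -[s'](subrKC s).
  apply: (fwdn (Num.bound ((s' - s) / delta))) => //.
  rewrite subr_ge0 ss'/= -ler_pdivrMr// ltW// archi_boundP//.
  by rewrite divr_ge0 ?subr_ge0// ltW.
have back n s : T <= s ->
    `|a s| <= expR (kappa * (n%:R * delta)) * `|a (s + n%:R * delta)|.
  elim: n => [|n IH] Ts; first by rewrite !mul0r mulr0 expR0 mul1r addr0.
  apply: le_trans (IH Ts) _.
  rewrite -natr1 mulrDl mul1r mulrDr expRD -mulrA ler_wpM2l ?expR_ge0// addrA.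
  have [//|_ + _] := HS (s + n%:R * delta).
    by rewrite ler_wpDr// mulr_ge0// ltW.
  by [].
(* The extra [delta] keeps the auxiliary point [s2] below at least [T]. The factor 2 counts two
   forward increments from [s2], and e^(kappa delta) pays for rounding [s - s'] up to a multiple of
   [delta]. *)
exists (T + delta), (2 * M1 * expR (kappa * delta)); split.
  by rewrite mulr_ge0 ?expR_ge0 ?mulr_ge0.
have k0 : 0 < kappa by lra.
have ek : 1 <= expR (kappa * delta).
  by rewrite -expR0 ler_expR mulr_ge0// ltW.
move=> s s' Ts Ts'.
have [ss'|s's] := leP s s'.
  apply: le_trans (fwd s s' _ ss') _; first by lra.
  rewrite -[leLHS]mulr1 ler_pM ?mulr_ge0//; last by rewrite lerDl expR_ge0.
  rewrite ler_wpM2r// mulrAC ler_peMl//.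
  by apply: le_trans ek _; rewrite ler_peMl ?expR_ge0// ler1n.
(* For [s' < s], both points are compared with [s2], at most [delta] below [s'] and
   a whole number of steps below [s]: [a] is compared only along steps [delta],
   as it need not be locally bounded. *)
pose n := (Num.trunc ((s - s') / delta)).+1.
have /andP[n1 n2] : n.-1%:R <= (s - s') / delta < n%:R.
  by apply: trunc_itv; rewrite divr_ge0 ?subr_ge0// ltW.
rewrite ler_pdivlMr// in n1; rewrite ltr_pdivrMr// in n2.
pose s2 := s - n%:R * delta.
have Ts2 : T <= s2.
  rewrite /s2 /n -natr1 mulrDl mul1r; rewrite /= in n1; lra.
have s2s' : s2 <= s' by rewrite /s2; lra.
have -> : phi s' - phi s = (phi s' - phi s2) - (phi s - phi s2) by ring.
apply: le_trans (ler_normB _ _) _.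
apply: le_trans (lerD (fwd _ _ Ts2 s2s') (fwd _ _ Ts2 (ltW (le_lt_trans s2s' s's)))) _.
rewrite -mulr2n -[leLHS]mulr_natl -!mulrA ler_pM2l// ler_wpM2l//.
apply: le_trans (back n _ Ts2) _; rewrite /s2 subrK.
rewrite [leRHS]mulrA [leRHS]mulrAC ler_wpM2r//.
apply: (@le_trans _ _ (expR (kappa * delta) * expR (kappa * (s - s')))).
  by rewrite -expRD ler_expR -mulrDr ler_pM2l// /n -natr1 mulrDl mul1r addrC lerD2l.
by rewrite ler_wpM2l ?expR_ge0// lerDr.
Unshelve. all: by end_near. Qed.

(** * Elementary estimates for logarithms, exponentials and powers *)

Lemma ln_ge1BV {R : realType} (r : R) : 0 < r -> 1 - r^-1 <= ln r.
Proof.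
move=> r0; have := @le_ln1Dx R (r^-1 - 1).
rewrite subrKC lnV ?posrE// ltrBrDr addNr invr_gt0 => /(_ r0); lra.
Qed.

Lemma ln_le_subr1 {R : realType} (r : R) : 0 < r -> ln r <= r - 1.
Proof. by move=> r0; have := @le_ln1Dx R (r - 1); rewrite subrKC; apply; lra. Qed.

(** Since 1 - 1/r <= ln r <= r - 1, the error of replacing ln r by r - 1 is at most (r - 1)^2 / r.
    Divided by [b], it is a convergent factor times one tending to 0. *)
Lemma cvg_ln_div {R : realType} {T : Type} {F : set_system T} {FF : ProperFilter F}
    (r b : T -> R) (l : R) :
  (\forall x \near F, 0 < r x) -> r x @[x --> F] --> (1 : R) ->
  (r x - 1) / b x @[x --> F] --> l -> ln (r x) / b x @[x --> F] --> l.
Proof.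
move=> r0 r1 rb.
rewrite -[l]addr0.
have err : (ln (r x) - (r x - 1)) / b x @[x --> F] --> (0 : R).
  apply/norm_cvg0P.
  apply: (@squeeze_cvgr _ _ _ _ (cst 0)
      (fun x => `|(r x - 1) / b x| * (`|r x - 1| / r x))).
  - near=> x; have rx0 : 0 < r x by near: x.
    rewrite normr_ge0/= !normrM mulrAC ler_wpM2r//.
    rewrite mulrA -normrM ler0_norm; last by have := ln_le_subr1 _ rx0; lra.
    rewrite ger0_norm -?expr2 ?sqr_ge0//.
    apply: (@le_trans _ _ ((r x - 1) - (1 - (r x)^-1))).
      by have := ln_ge1BV _ rx0; lra.
    rewrite le_eqVlt; apply/orP; left; apply/eqP; field.
    by rewrite gt_eqF.
  - exact: cvg_cst.
  - have -> : (0 : R) = `|l| * (`|1 - 1| / 1) by rewrite subrr normr0 mul0r mulr0.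
    apply: cvgM; first exact: cvg_norm.
    apply: cvgM; last by apply: cvgV => //; exact: oner_neq0.
    by apply: cvg_norm; apply: cvgB => //; exact: cvg_cst.
apply: cvg_trans (cvgD rb err).
apply: near_eq_cvg; near=> x.
rewrite -[LHS]/((r x - 1) / b x + (ln (r x) - (r x - 1)) / b x); ring.
Unshelve. all: by end_near. Qed.

Lemma expn_expRN_bounded {R : realType} (c : R) (m : nat) : 0 < c ->
  exists2 C : R, 0 <= C & forall y, 0 <= y -> y ^+ m * expR (- (c * y)) <= C.
Proof.
move=> c0; case: m => [|m].
  by exists 1 => // y y0; rewrite expr0 mul1r -expR0 ler_expR oppr_le0 mulr_ge0// ltW.
(* From keeping the single term (c y)^(m+1) / (m+1)! of the exponential series. *)
exists (m.+1`!%:R / c ^+ m.+1).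
  by rewrite divr_ge0// exprn_ge0// ltW.
move=> y y0.
have cy : 0 <= c * y by rewrite mulr_ge0// ltW.
rewrite expRN ler_pdivrMr ?expR_gt0// mulrAC ler_pdivlMr ?exprn_gt0//.
rewrite mulrC -exprMn -ler_pdivrMl ?ltr0n ?fact_gt0// mulrC.
by apply: le_trans (expR_ge1Dxn m cy); rewrite lerDr.
Qed.

Lemma expRN_le_inv {R : realType} (w : R) : 0 < w -> expR (- w) <= w^-1.
Proof.
move=> w0; rewrite expRN lef_pV2 ?posrE ?expR_gt0//.
by apply: le_trans (expR_ge1Dx w); rewrite lerDr.
Qed.

Lemma subrX_le {R : realType} (x y : R) (n : nat) : 0 <= y <= x ->
  x ^+ n - y ^+ n <= n%:R * (x - y) * x ^+ n.-1.
Proof.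
move=> /andP[y0 yx]; have x0 := le_trans y0 yx.
case: n => [|n]; first by rewrite !expr0 subrr !mul0r.
elim: n => [|n IH]; first by rewrite !expr1 expr0 mul1r mulr1.
have -> : x ^+ n.+2 - y ^+ n.+2 = x * (x ^+ n.+1 - y ^+ n.+1) + (x - y) * y ^+ n.+1.
  by rewrite !exprS; ring.
have -> : n.+2%:R * (x - y) * x ^+ n.+2.-1 =
    x * (n.+1%:R * (x - y) * x ^+ n.+1.-1) + (x - y) * x ^+ n.+1.
  by rewrite /= -natr1 !exprS; ring.
by rewrite lerD ?ler_wpM2l ?subr_ge0// lerXn2r ?nnegrE.
Qed.

(** As 0 <= e^(-v) - (1 - v) <= v^2, the difference of the n-th powers is at most n v^2 e^(-(n-1)v).
    For n >= 2 one has n - 1 >= n/2, and e^w >= w^2/2 at w = nv/2 gives the constant 8. *)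
Lemma exprn_expR_dist {R : realType} (v : R) (n : nat) : (2 <= n)%N -> 0 <= v <= 1 ->
  `|(1 - v) ^+ n - expR (- (n%:R * v))| <= 8 / n%:R.
Proof.
move=> n2 /andP[v0 v1].
have n0 : 0 < n%:R :> R by rewrite ltr0n (leq_trans _ n2).
have vexp : 1 - v <= expR (- v) by exact: expR_ge1Dx.
have vexp2 : expR (- v) - (1 - v) <= v ^+ 2.
  have : expR (- v) <= (1 + v)^-1.
    by rewrite expRN lef_pV2 ?posrE ?expR_gt0 ?expR_ge1Dx//; lra.
  move=> /lerB-/(_ (1 - v) (1 - v) (lexx _)) /le_trans; apply.
  have -> : (1 + v)^-1 - (1 - v) = v ^+ 2 / (1 + v) by field; lra.
  rewrite ler_pdivrMr ?ler_peMr ?sqr_ge0//; lra.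
have bd : 0 <= 1 - v <= expR (- v) by rewrite vexp subr_ge0 v1.
rewrite -mulrN expRM_natl distrC ger0_norm; last first.
  by rewrite subr_ge0 lerXn2r ?nnegrE ?expR_ge0// subr_ge0.
apply: le_trans (subrX_le _ _ n bd) _.
have hexp : expR (- v) ^+ n.-1 <= expR (- (n%:R * v / 2)).
  rewrite -expRM_natl ler_expR mulrN lerN2 mulrAC ler_wpM2r//.
  rewrite ler_pdivrMr// -natrM ler_nat muln2 -addnn.
  by case: n n2 {n0} => [//|[//|n]] _; rewrite /= addnS ltnS leq_addr.
apply: (@le_trans _ _ (n%:R * v ^+ 2 * expR (- (n%:R * v / 2)))).
  by rewrite ler_pM ?exprn_ge0 ?expR_ge0 ?mulr_ge0 ?ler_wpM2l// subr_ge0.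
rewrite expRN ler_pdivrMr ?expR_gt0// mulrAC ler_pdivlMr//.
have : 0 <= n%:R * v / 2 by rewrite divr_ge0// mulr_ge0// ltW.
move=> /(expR_ge1Dxn 1); rewrite (_ : 2`!%:R = 2 :> R)// => e2.
have {e2} : 1 + (n%:R * v / 2) ^+ 2 / 2 <= expR (n%:R * v / 2) by exact: e2.
move=> /(ler_wpM2l (ler0n R 8)) /(le_trans _); apply.
have -> : (n%:R * v / 2) ^+ 2 / 2 = n%:R * v ^+ 2 * n%:R / 8 :> R by field.
lra.
Qed.

Lemma expRN_dist_le {R : realType} (x y : R) : 0 <= x <= y ->
  `|expR (- y) - expR (- x)| <= expR (- x) * (y - x).
Proof.
move=> /andP[x0 xy]; rewrite distrC ger0_norm; last by rewrite subr_ge0 ler_expR lerN2.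
have -> : - y = - x + - (y - x) by ring.
rewrite expRD -{1}[expR (- x)]mulr1 -mulrBr ler_wpM2l ?expR_ge0//.
have := expR_ge1Dx (- (y - x)); lra.
Qed.

(** A mean value estimate: the exponents differ by y |e^D - 1| <= e^B |D| y, and both are at least
    e^(-B) y in size. The decay in y is kept so that it can later absorb powers of y. *)
Lemma expRN_expR_dist {R : realType} (y D B : R) : 0 <= y -> `|D| <= B ->
  `|expR (- (y * expR D)) - expR (- y)| <=
    expR B * `|D| * (y * expR (- (expR (- B) * y))).
Proof.
move=> y0 DB.
have B0 : 0 <= B by exact: le_trans DB.
have eB1 : 1 <= expR B by rewrite -expR0 ler_expR.
have eNB1 : expR (- B) <= 1 by rewrite -expR0 ler_expR oppr_le0.
have D1 : expR D - 1 <= D * expR D.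
  have := expR_ge1Dx (- D); rewrite expRN.
  move=> /(ler_wpM2r (expR_ge0 D)); rewrite mulVf ?gt_eqF ?expR_gt0//; lra.
have [D0|D0] := leP 0 D.
  have eD1 : 1 <= expR D by rewrite -expR0 ler_expR.
  apply: le_trans (expRN_dist_le y _ _) _; first by rewrite y0 ler_peMr.
  have -> : expR (- y) * (y * expR D - y) = (expR D - 1) * (y * expR (- y)).
    by ring.
  rewrite ler_pM ?mulr_ge0 ?expR_ge0 ?subr_ge0//.
    apply: le_trans D1 _; rewrite (ger0_norm D0) mulrC ler_wpM2r// ler_expR.
    by apply: le_trans DB; exact: ler_norm.
  by rewrite ler_wpM2l// ler_expR lerN2 ler_piMl.
have eD1 : expR D <= 1 by rewrite -expR0 ler_expR ltW.
rewrite distrC; apply: le_trans (expRN_dist_le (y * expR D) _ _) _.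
  by rewrite mulr_ge0 ?expR_ge0//= ler_piMr.
have -> : expR (- (y * expR D)) * (y - y * expR D) =
  (1 - expR D) * (y * expR (- (y * expR D))) by ring.
rewrite ler_pM ?mulr_ge0 ?expR_ge0 ?subr_ge0//.
  apply: (@le_trans _ _ `|D|); last by rewrite ler_peMl.
  by rewrite (ler0_norm (ltW D0)); have := expR_ge1Dx D; lra.
rewrite ler_wpM2l// ler_expR lerN2 mulrC ler_wpM2l// ler_expR lerNl.
by apply: le_trans DB; rewrite -normrN; exact: ler_norm.
Qed.

(** * Potter-type expansion of the tail ratio *)

Lemma expR_cvgy {R : realType} : expR s @[s --> +oo] --> (+oo : set_system R).
Proof.
apply: ger_cvgy (cvg_id (F := nbhs (+oo : set_system R))).
by near=> s; apply: le_trans (expR_ge1Dx s); rewrite lerDr.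
Unshelve. all: by end_near. Qed.

Lemma tail_ratio_expansion {R : realType} {alpha rho : R} {A h : R -> R} :
  0 < alpha -> rho < 0 -> continuous h -> (forall x, 0 < h x) ->
  second_order_regularly_varying (- alpha) rho A h ->
  exists (m : nat) (T B M : R), [/\ 0 < T, 0 <= B, 0 <= M &
    forall t x, 0 < x -> T <= t -> T <= t * x ->
      exists D, [/\ h (t * x) / h t = x `^ (- alpha) * expR D, `|D| <= B &
        `|D| <= M * `|A t| * (1 + (x `^ (- alpha)) ^+ m)]].
Proof.
move=> alpha0 rho0 ch h0 [rvh signA soh].
pose phi s := ln (h (expR s)) + alpha * s.
pose a s := A (expR s).
have expRK' := @expR_cvgy R.
have a0 : \forall s \near +oo, a s != 0.
  apply: (expRK' [set t | A t != 0]).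
  by case: signA; apply: filterS => t At /=; rewrite ?(gt_eqF At) ?(lt_eqF At).
have cphi : continuous phi.
  move=> s; apply: cvgD; last exact: mulrl_continuous.
  apply: (@cvg_comp _ _ _ (fun s => h (expR s)) (@ln R) _ (nbhs (h (expR s)))).
    apply: (@cvg_comp _ _ _ expR h _ (nbhs (expR s))); last exact: ch.
    exact: continuous_expR.
  apply: continuous_ln; exact: h0.
have phiE s u : phi (s + u) - phi s =
    ln (h (expR s * expR u) / h (expR s) / expR u `^ (- alpha)).
  rewrite -expRM !ln_div ?posrE ?divr_gt0 ?expR_gt0// expRK /phi expRD; ring.
have phia u : (phi (s + u) - phi s) / a s @[s --> +oo] --> (expR (rho * u) - 1) / rho.
  under eq_fun do rewrite phiE.
  have xg0 : expR u `^ (- alpha) != 0 by rewrite gt_eqF ?powR_gt0 ?expR_gt0.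
  (* With x = e^u and r the tail ratio divided by x^(-alpha), the second-order condition gives the
     limit of (r - 1) / a; the same limit then holds for ln r / a. *)
  apply: cvg_ln_div.
  - by near=> s; rewrite !divr_gt0// powR_gt0// expR_gt0.
  - rewrite -(divff xg0); apply: cvgM; last exact: cvg_cst.
    exact: (cvg_comp _ _ expRK' (rvh _ (expR_gt0 u))).
  - have := cvg_comp _ _ expRK' (soh _ (expR_gt0 u)).
    move=> /(cvgM (cvg_cst (expR u `^ (- alpha))^-1)).
    rewrite mulKf// (mulrC rho) expRM; apply: cvg_trans.
    apply: near_eq_cvg; near=> s.
    have as0 : a s != 0 by near: s.
    rewrite -[LHS]/((expR u `^ (- alpha))^-1 * ((A (expR s))^-1 *
      (h (expR s * expR u) / h (expR s) - expR u `^ (- alpha)))).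
    by rewrite /a; field; rewrite as0 xg0 gt_eqF.
(* Choosing kappa = alpha m turns e^(- kappa u) into an integer power of x^(-alpha). *)
pose m := (Num.bound (- rho / alpha)).
have rhom : - rho < alpha * m%:R.
  rewrite mulrC -ltr_pdivrMr// archi_boundP//.
  by rewrite divr_ge0// ?oppr_ge0 ltW.
have [S [M [M0 bd]]] := uniform_increment (alpha * m%:R) rho0 rhom cphi a0 phia.
exists m, (expR S), (4 * M * `|a S| ), M; split => //.
- by rewrite expR_gt0.
- by rewrite !mulr_ge0.
move=> t x x0 St Stx.
have t0 : 0 < t by apply: lt_le_trans St; exact: expR_gt0.
have tx0 : 0 < t * x by rewrite mulr_gt0.
pose s := ln t; pose u := ln x.
have sE : expR s = t by rewrite lnK.
have uE : expR u = x by rewrite lnK.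
have suE : expR (s + u) = t * x by rewrite expRD sE uE.
have Ss : S <= s by rewrite -ler_expR sE.
have Ssu : S <= s + u by rewrite -ler_expR suE.
exists (phi (s + u) - phi s); split.
- rewrite phiE lnK ?posrE ?divr_gt0// ?powR_gt0 ?expR_gt0//.
  by rewrite sE uE [RHS]mulrC divfK// gt_eqF// powR_gt0.
- have k0 : 0 <= alpha * m%:R by rewrite mulr_ge0// ltW.
  (* The bound in [|A t|] grows as x tends to 0. A uniform one comes from comparing both points with
     [S]: the increments then go forward and the exponential term is at most 1. *)
  have bdS s' : S <= s' -> `|phi s' - phi S| <= M * `|a S| * 2.
    move=> Ss'; apply: le_trans (bd _ _ (lexx S) Ss') _.
    rewrite ler_wpM2l ?mulr_ge0// -[leRHS]/(1 + 1) lerD2l -[leRHS]expR0 ler_expR.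
    by rewrite mulr_ge0_le0// subr_le0.
  have -> : phi (s + u) - phi s = (phi (s + u) - phi S) - (phi s - phi S) by ring.
  apply: le_trans (ler_normB _ _) _.
  have := bdS _ Ss; have := bdS _ Ssu; lra.
- apply: le_trans (bd _ _ Ss Ssu) _.
  rewrite -{1}sE ler_wpM2l ?mulr_ge0// lerD2l.
  rewrite -uE -expRM -expRM_natr ler_expR.
  rewrite le_eqVlt; apply/orP; left; apply/eqP; ring.
Unshelve. all: by end_near. Qed.

(** * Pointwise comparison with the Fréchet distribution function *)

(** The normalization 1 - F t = 1/n makes n (1 - F (t z)) equal to the tail ratio at (t, z), to
    which the expansion applies. *)
Lemma frechet_approximation {R : realType} (alpha : {posnum R}) (rho : R)
    (A F : R -> R) :
  rho < 0 -> continuous F -> nondecreasing F ->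
  (forall x, 0 <= F x) -> (forall x, F x < 1) ->
  second_order_regularly_varying (- alpha%:num) rho A (fun x => 1 - F x) ->
  exists T C : R, [/\ 0 < T, 0 < C & forall (n : nat) (t z : R),
    (2 <= n)%N -> T <= t -> 1 - F t = n%:R^-1 ->
    `|F (t * z) ^+ n - frechet_cdf alpha z| <= C * (n%:R^-1 + `|A t|)].
Proof.
have al0 : 0 < alpha%:num by [].
set al := alpha%:num in al0 * => rho0 cF ndF F0 F1 soF.
have ch : continuous (fun x => 1 - F x).
  by move=> x; apply: cvgB; [exact: cvg_cst|exact: cF].
have h0 x : 0 < 1 - F x by rewrite subr_gt0.
have [m [T [B [M [T0 B0 M0 exps]]]]] := tail_ratio_expansion al0 rho0 ch h0 soF.
have c0 : 0 < expR (- B) by exact: expR_gt0.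
have [C1 C10 C1P] := expn_expRN_bounded _ 1 c0.
have [C2 C20 C2P] := expn_expRN_bounded _ m.+1 c0.
have eB1 : 1 <= expR B by rewrite -expR0 ler_expR.
(* [K1] serves for t z < T, where both functions are O(1/n). [K2] serves for the error due to D
   elsewhere: with y = z^(-alpha), [C1] and [C2] absorb the two terms of y (1 + y^m). The 8 in the
   final constant comes from [exprn_expR_dist]. *)
pose K1 := expR B / (1 - F T).
pose K2 := expR B * M * (C1 + C2).
have K10 : 0 <= K1 by rewrite divr_ge0 ?expR_ge0 ?ltW.
have K20 : 0 <= K2 by rewrite !mulr_ge0 ?expR_ge0 ?addr_ge0.
exists T, (8 + K1 + K2); split => //; first by lra.
move=> n t z n2 Tt tn.
have n0 : 0 < n%:R :> R by rewrite ltr0n (leq_trans _ n2).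
have nV0 : 0 <= n%:R^-1 :> R by rewrite invr_ge0 ltW.
have t0 : 0 < t by exact: lt_le_trans Tt.
have ratio x : 1 - F (t * x) = n%:R^-1 * ((1 - F (t * x)) / (1 - F t)).
  by rewrite -tn mulrCA mulfV ?mulr1// gt_eqF.
have h01 x : 0 <= 1 - F x <= 1 by rewrite ltW//= gerBl.
have powE x : `|F x ^+ n - expR (- (n%:R * (1 - F x)))| <= 8 / n%:R.
  by have := exprn_expR_dist (1 - F x) n n2 (h01 x); rewrite subKr.
have [tzT|Ttz] := ltP (t * z) T.
  have Fz : 0 <= F (t * z) ^+ n <= K1 / n%:R.
    rewrite exprn_ge0//=.
    apply: (@le_trans _ _ (F T ^+ n)).
      by rewrite lerXn2r ?nnegrE// ndF// ltW.
    apply: (@le_trans _ _ (expR (- (n%:R * (1 - F T))))).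
      rewrite -mulrN expRM_natl lerXn2r ?nnegrE ?expR_ge0//.
      by have := expR_ge1Dx (- (1 - F T)); lra.
    apply: le_trans (expRN_le_inv _ _) _; first by rewrite mulr_gt0.
    rewrite invfM mulrC ler_wpM2r// /K1 ler_peMl//.
    by rewrite invr_ge0 ltW.
  (* By monotonicity it suffices to treat the positive point T / t, which also covers z <= 0. There
     the expansion reads 1 - F T = y e^D / n, so e^(-y) <= 1/y <= K1 / n. *)
  have Gz : 0 <= frechet_cdf alpha z <= K1 / n%:R.
    have G0 x : 0 <= frechet_cdf alpha x.
      by rewrite /frechet_cdf; case: ifPn => // _; exact: expR_ge0.
    rewrite G0/=.
    have Tt0 : 0 < T / t by rewrite divr_gt0.
    have zT : z <= T / t by rewrite ler_pdivlMr// mulrC ltW.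
    apply: le_trans (@frechet_cdf_nondecreasing _ alpha _ _ zT) _.
    have tT : t * (T / t) = T by rewrite mulrC divfK// gt_eqF.
    have [|D [ratioD DB _]] := exps t (T / t) Tt0 Tt; rewrite ?tT//.
    rewrite /frechet_cdf Tt0 -/al.
    set y := _ `^ _ in ratioD *.
    have y0 : 0 < y by rewrite powR_gt0.
    apply: le_trans (expRN_le_inv _ y0) _.
    have hT := ratio (T / t); rewrite ratioD tT in hT.
    have -> : K1 / n%:R = y^-1 * expR (B - D).
      rewrite /K1 hT expRB; field.
      by rewrite (gt_eqF n0) (gt_eqF y0) gt_eqF ?expR_gt0.
    rewrite ler_peMr ?invr_ge0 ?(ltW y0)// -[leLHS]expR0 ler_expR subr_ge0.
    by apply: le_trans DB; exact: ler_norm.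
  have : `|F (t * z) ^+ n - frechet_cdf alpha z| <= K1 * n%:R^-1.
    by rewrite ler_norml; lra.
  move=> /le_trans; apply.
  rewrite mulrDr -[leLHS]addr0 lerD ?mulr_ge0//; last by lra.
  by rewrite ler_wpM2r//; lra.
have z0 : 0 < z by rewrite -(pmulr_rgt0 z t0); exact: lt_le_trans Ttz.
have [D [ratioD DB Dbd]] := exps t z z0 Tt Ttz.
have := powE (t * z); rewrite ratio mulVKf ?gt_eqF// ratioD /frechet_cdf z0 -/al.
set y := _ `^ _ in ratioD Dbd * => powz.
have y0 : 0 <= y by exact: powR_ge0.
have e2 : `|expR (- (y * expR D)) - expR (- y)| <= K2 * `|A t|.
  apply: le_trans (expRN_expR_dist y D B y0 DB) _.
  apply: (@le_trans _ _ (expR B * (M * `|A t| * (1 + y ^+ m)) *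
      (y * expR (- (expR (- B) * y))))).
    by rewrite ler_wpM2r ?mulr_ge0 ?expR_ge0// ler_wpM2l ?expR_ge0.
  have -> : expR B * (M * `|A t| * (1 + y ^+ m)) * (y * expR (- (expR (- B) * y))) =
    expR B * M * (y ^+ 1 * expR (- (expR (- B) * y)) +
      y ^+ m.+1 * expR (- (expR (- B) * y))) * `|A t|.
    by rewrite expr1 exprS; ring.
  by rewrite ler_wpM2r// ler_wpM2l ?mulr_ge0 ?expR_ge0// lerD ?C1P ?C2P.
apply: le_trans (ler_distD (expR (- (y * expR D))) _ _) _.
apply: le_trans (lerD powz e2) _.
by rewrite mulrDr lerD// ler_wpM2r//; lra.
Qed.

(** * Quantiles, positivity of the tail and the law of the maximum *)

(** The limits at infinity make the set nonempty and bounded below, so [inf] is a genuine infimum q.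
    By continuity, F q < y would persist just to the right of q and y < F q just to the left, each
    contradicting the choice of q. *)
Lemma cdf_quantile {R : realType} (F : R -> R) (y : R) : continuous F ->
  F x @[x --> -oo] --> (0 : R) -> F x @[x --> +oo] --> (1 : R) ->
  0 < y < 1 -> F (quantile F y) = y.
Proof.
move=> cF FNy Fy /andP[y0 y1].
pose E := [set x | y <= F x].
have E0 : E !=set0.
  have [M [_ HM]] := cvgr_ge _ Fy _ y1.
  by exists (M + 1); apply: HM; rewrite ltrDl.
have lbE : has_lbound E.
  have [M [_ HM]] := cvgr_lt _ FNy _ y0.
  exists M => x /= Ex; rewrite leNgt; apply/negP => /HM; rewrite ltNge.
  by rewrite Ex.
rewrite /quantile -/E; set q := inf E.
have qE : y <= F q.
  rewrite leNgt; apply/negP => qy.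
  have nq : nbhs q [set x | F x < y] by exact: cvgr_lt (cF q) _ qy.
  have /nbhs_ballP[e /= e0 He] := nq.
  have [x Ex xq] := inf_adherent e0 (conj E0 lbE).
  have : F x < y.
    apply: He; rewrite /ball/= distrC ger0_norm; last by rewrite subr_ge0 ge_inf.
    by rewrite ltrBlDl.
  by rewrite ltNge Ex.
apply/eqP; rewrite eq_le qE andbT leNgt; apply/negP => qy.
have nq : nbhs q [set x | y < F x] by exact: cvgr_gt (cF q) _ qy.
have /nbhs_ballP[e /= e0 He] := nq.
have : E (q - e / 2).
  apply/ltW/He; rewrite /ball/= opprB addrCA subrr addr0 gtr0_norm ?divr_gt0//.
  by rewrite ltr_pdivrMr// ltr_pMr// ltr1n.
by move=> /(ge_inf lbE); rewrite -/q lerBrDr gerDl leNgt divr_gt0.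
Qed.

(** A zero of [h] would make [h] vanish from there on; with the convention 0 / 0 = 0, the ratio
    [h (t * 2) / h t] would then be eventually 0, against its positive limit 2^gamma. *)
Lemma regularly_varying_nonincreasing_gt0 {R : realType} (gamma : R) (h : R -> R) :
  nonincreasing_fun h -> (forall x, 0 <= h x) -> regularly_varying gamma h ->
  forall x, 0 < h x.
Proof.
move=> nih h0 rvh x; rewrite lt_neqAle h0 andbT eq_sym; apply/negP => /eqP hx.
have [M [_ HM]] : \forall t \near +oo, 0 < h (t * 2) / h t.
  by apply: cvgr_gt (rvh 2 _) _ _; rewrite ?powR_gt0.
have := HM (Num.max M x + 1).
rewrite (@le_lt_trans _ _ (Num.max M x)) ?ltrDl ?le_max ?lexx// => /(_ isT).
suff -> : h (Num.max M x + 1) = 0 by rewrite invr0 mulr0 ltxx.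
apply/eqP; rewrite eq_le h0 andbT -hx; apply: nih.
by rewrite (@le_trans _ _ (Num.max M x)) ?lerDl// le_max lexx orbT.
Qed.

Lemma real_cdfE {R : realType} {d : measure_display} {T : measurableType d}
    {P : probability T R} (X : {RV P >-> R}) (x : R) :
  cdf X x = (real_cdf X x)%:E.
Proof. by rewrite /real_cdf fineK// fin_num_measure. Qed.

Lemma distribution_scaled_sample_max {R : realType} {d : measure_display}
    {T : measurableType d} {P : probability T R} (X : nat -> {RV P >-> R})
    (a : R) (n : nat) (z : R) : iid X -> 0 < a -> (0 < n)%N ->
  distribution P (a^-1 \o* sample_max X n) `]-oo, z]%classic =
    (real_cdf (X 0%N) (a * z) ^+ n)%:E.
Proof.
move=> [indX idX] a0 n0.
have ray (f : T -> R) (b : R) : f @^-1` `]-oo, b]%classic = [set w | f w <= b].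
  by apply/seteqP; split=> w /=; rewrite in_itv.
have -> : distribution P (a^-1 \o* sample_max X n) `]-oo, z]%classic =
    P (\bigcap_(i in [set` iota 0 n]) (X i @^-1` `]-oo, a * z]%classic)).
  rewrite /distribution/= /pushforward ray; congr (P _).
  apply/seteqP; split=> w /=.
    rewrite ler_pdivrMr// [z * a]mulrC => /bigmax_leP[_ le_az] i /=.
    rewrite mem_iota in_itv/= add0n => ltin.
    exact: (le_az (Ordinal ltin)).
  move=> le_az; rewrite ler_pdivrMr// [z * a]mulrC.
  have le_az' i : (i < n)%N -> X i w <= a * z.
    by move=> ltin; have := le_az i; rewrite /= mem_iota in_itv/=; apply.
  (* The starting value [X 0] of the maximum is itself one of the first n variables, since 0 < n. *)
  by apply/bigmax_leP; split=> [|i _]; exact: le_az'.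
rewrite indX ?iota_uniq//.
rewrite (eq_bigr (fun=> (real_cdf (X 0%N) (a * z))%:E)); last first.
  by move=> i _; rewrite -real_cdfE; exact: (idX i 0%N).
by rewrite prodEFin -[n in iota 0 n]subn0 prodr_const_nat subn0.
Qed.

(** * Passage to the Kolmogorov distance *)

Theorem theorem3p4 (R : realType) (d : measure_display) (T : measurableType d)
    (P : probability T R) (X : nat -> {RV P >-> R})
    (alpha : {posnum R}) (rho : R) (A : R -> R) :
  let F := real_cdf (X 0%N) in
  let a := fun n : nat => quantile F (1 - n%:R^-1) in
  rho < 0 ->
  iid X ->
  continuous F ->
  second_order_regularly_varying (- alpha%:num) rho A (fun x => 1 - F x) ->
  exists C : R, 0 < C /\
    forall n : nat, (2 <= n)%N -> 0 < a n ->
      kolmogorov_distance (distribution P ((a n)^-1 \o* sample_max X n))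
                          (frechet alpha)
      <= C * (n%:R^-1 + `|A (a n)|).
Proof.
move=> F a rho0 iidX cF soF.
have cdfF : cdf (X 0%N) = EFin \o F by apply/funext => x; exact: real_cdfE.
have F0 x : 0 <= F x by rewrite -lee_fin -real_cdfE cdf_ge0.
have F1 x : F x <= 1 by rewrite -lee_fin -real_cdfE cdf_le1.
have ndF : nondecreasing F.
  by move=> x y xy; rewrite -lee_fin -!real_cdfE cdf_nondecreasing.
have Flt1 x : F x < 1.
  rewrite -subr_gt0; have [rvF _ _] := soF.
  apply: (regularly_varying_nonincreasing_gt0 _ _ _ _ rvF) => [u v uv|u].
    by rewrite lerB// ndF.
  by rewrite subr_ge0.
have FNy : F x @[x --> -oo] --> (0 : R).
  by have := cvg_cdfNy0 (X 0%N); rewrite cdfF => /fine_cvg.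
have Fy : F x @[x --> +oo] --> (1 : R).
  by have := cvg_cdfy1 (X 0%N); rewrite cdfF => /fine_cvg.
have [t0 [C [_ C0 approx]]] := frechet_approximation _ _ _ _ rho0 cF ndF F0 Flt1 soF.
(* For n >= n0 one has 1/n < 1 - F t0, which forces a_n >= t0, so [approx] applies. For n < n0 the
   distance is at most 1 <= n0 / n, which accounts for the summand [n0] in the constant. *)
pose n0 := Num.bound (1 - F t0)^-1.
have ht0 : 0 < 1 - F t0 by rewrite subr_gt0.
exists (C + n0%:R); split; first by rewrite ltr_wpDr.
move=> n n2 an0.
have np : 0 < n%:R :> R by rewrite ltr0n (leq_trans _ n2).
have Fan : 1 - F (a n) = n%:R^-1.
  rewrite /a cdf_quantile ?subKr// subr_gt0 invf_lt1// ltr1n n2/=.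
  by rewrite gtrBl invr_gt0.
apply: ge_sup => [|_ [z _ <-]].
  by eexists; exists 0.
rewrite [X in fine X - _](_ : _ = (F (a n * z) ^+ n)%:E); last first.
  by apply: distribution_scaled_sample_max => //; exact: leq_trans n2.
rewrite [X in _ - fine X](_ : _ = (frechet_cdf alpha z)%:E) /=; last exact: frechetE.
have [nn0|n0n] := ltnP n n0.
  have Fn : 0 <= F (a n * z) ^+ n <= 1 by rewrite exprn_ge0// exprn_ile1.
  have Gz : 0 <= frechet_cdf alpha z <= 1.
    rewrite /frechet_cdf; case: ifPn => _; last by rewrite lexx ler01.
    by rewrite expR_ge0/= -[leRHS]expR0 ler_expR oppr_le0 powR_ge0.
  apply: (@le_trans _ _ (n0%:R * n%:R^-1)).
    apply: (@le_trans _ _ 1); first by rewrite ler_norml; lra.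
    by rewrite ler_pdivlMr// mul1r ler_nat ltnW.
  rewrite mulrDr -[leLHS]addr0 lerD ?mulr_ge0 ?addr_ge0 ?(ltW C0)//.
  by rewrite ler_wpM2r ?invr_ge0// lerDr ltW.
have t0an : t0 <= a n.
  rewrite leNgt; apply/negP => ant0.
  have : 1 - F t0 <= n%:R^-1 by rewrite -Fan lerB// ndF// ltW.
  rewrite leNgt => /negP; apply.
  rewrite invf_plt ?posrE//; apply: lt_le_trans (archi_boundP _) _.
    by rewrite invr_ge0 ltW.
  by rewrite ler_nat.
apply: le_trans (approx n (a n) z n2 t0an Fan) _.
by rewrite ler_wpM2r ?addr_ge0 ?invr_ge0// lerDl.
Qed.
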